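(* Let $G$ be a graph of order $n$ with $m$ edges and degree sequence $d_1\le d_2\le\cdots\le d_n$. Then $\alpha(G)\le p_2(G)\le p_1(G)\le p(G)$, where $p(G):=\lfloor\frac{1}{2}+\sqrt{\frac{1}{4}+n^2-n-2m}\rfloor$ and $p_1(G):=\max\{i\mid d_i\le n-i\}$.
   Context: Graphs are finite and simple; $\alpha(G)$ is the independence number, $N(u)$ the neighbourhood and $d(u)=|N(u)|$ the degree of a vertex $u$. For a vertex $u$, consider all vertices $v\ne u$ not adjacent to $u$ (there are $t-1$ of them, where $t=n-d(u)$), and let $n_2(u)\le n_3(u)\le\cdots\le n_t(u)$ be the nondecreasing sequence of the values $|N(u)\cup N(v)|$ over these vertices $v$. Define $p_2(G):=\max\{k \mid G \text{ has at least } k \text{ vertices } v \text{ with } n_k(v)\le n-k\}$, where for a vertex $v$ the condition $n_k(v)\le n-k$ with $k\ge 2$ requires $k\le n-d(v)$ (so that $n_k(v)$ is defined), and for $k=1$ the condition is regarded as satisfied by every vertex. *)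

(* Defs.v *)
(* MathComp world; the reals are an arbitrary [R : realType]. *)
From HB Require Import structures.
From mathcomp Require Import all_boot all_order all_algebra.
From mathcomp Require Import reals.

Set Implicit Arguments.
Unset Strict Implicit.
Unset Printing Implicit Defensive.

Record sgraph (T : finType) := SGraph {
  adj :> rel T;
  adj_sym : symmetric adj;
  adj_irrefl : irreflexive adj
}.

Section GraphBounds.
Variables (T : finType) (G : sgraph T).

Definition gorder : nat := #|T|.

Definition edges : {set {set T}} :=
  [set E : {set T} | [exists x, exists y, G x y && (E == [set x; y])]].

Definition nbh (u : T) : {set T} := [set v | G u v].

Definition deg (u : T) : nat := #|nbh u|.

Definition independent (S : {set T}) : bool :=
  [forall x in S, forall y in S, ~~ G x y].

Definition alpha : nat := \max_(S : {set T} | independent S) #|S|.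

(* The mathematical index is 1-based, the sequence is 0-based;
   [degseq i] is meaningful for [1 <= i <= gorder]. *)
Definition degseq (i : nat) : nat :=
  nth 0 (sort leq [seq deg v | v <- enum T]) i.-1.

(* The values |N(u) :|: N(v)| over the [gorder - deg u - 1] vertices [v != u]
   not adjacent to [u], with multiplicity, in nondecreasing order. *)
Definition union_sizes (u : T) : seq nat :=
  sort leq [seq #|nbh u :|: nbh v| | v <- enum T & (v != u) && ~~ G u v].

(* Numbered from 2: [nk u k] is meaningful for [2 <= k <= gorder - deg u]. *)
Definition nk (u : T) (k : nat) : nat := nth 0 (union_sizes u) (k - 2).

(* The condition n_k(v) <= n - k for [k >= 1]. It holds by convention for
   k = 1; for k >= 2 it includes that n_k(v) is defined. *)
Definition nk_cond (k : nat) (v : T) : bool :=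
  (k == 1) || [&& 2 <= k, k <= gorder - deg v & nk v k <= gorder - k].

(* No k > gorder can qualify, so bounding k by [gorder] loses nothing.
   For the graph without vertices, [p2] and [p1] are maxima over the empty
   set, with value 0. *)
Definition p2 : nat :=
  \max_(1 <= k < gorder.+1 | k <= #|[set v | nk_cond k v]|) k.

Definition p1 : nat :=
  \max_(1 <= i < gorder.+1 | degseq i <= gorder - i) i.

Local Open Scope ring_scope.

Definition p (R : realType) : int :=
  Num.floor (2^-1 + Num.sqrt (4^-1 + gorder%:R ^+ 2 - gorder%:R
                              - 2 * #|edges|%:R) : R).

End GraphBounds.

(* Main.v *)
(* Everything rests on counting values: the i-th entry of a sorted sequence is
   at most m iff at least i of its values are at most m.
   An independent set S of size k misses N(u) and N(v) for all u, v in S, so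
   the k - 1 other vertices of S give values |N(u) :|: N(v)| <= n - k. If
   d_i <= n - i, bounding the degrees of i vertices by n - i and the others by
   n - 1 gives 2m <= i(n - i) + (n - i)(n - 1), that is
   i^2 - i <= n^2 - n - 2m; completing the square bounds i. *)
Require Import Defs.
From HB Require Import structures.
From mathcomp Require Import all_boot all_order all_algebra.
From mathcomp Require Import reals.
From mathcomp Require Import zify lra.

Set Implicit Arguments.
Unset Strict Implicit.
Unset Printing Implicit Defensive.

Lemma nth_sort_leq (s : seq nat) (m i : nat) : i < size s ->
  (nth 0 (sort leq s) i <= m) = (i < count (leq^~ m) s).
Proof.
move=> lt_i_s; rewrite -(count_sort leq (leq^~ m)).
rewrite -(size_sort leq) in lt_i_s.
have := sort_sorted leq_total s; move: lt_i_s.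
move: (sort leq s) => t lt_i_t sorted_t.
have le_nth j k : j <= k < size t -> nth 0 t j <= nth 0 t k.
  case/andP=> le_jk lt_kt.
  by apply: (sorted_leq_nth leq_trans leqnn) => //; rewrite inE; lia.
(* If entry i is at most [m], so are entries 0 to i, which makes i + 1 of them. If it exceeds [m],
   so do all later ones, and at most i values can count. *)
apply/idP/idP => [le_im | ].
  have : all (leq^~ m) (take i.+1 t).
    apply/(all_nthP 0) => j; rewrite size_takel // => lt_ji.
    by rewrite nth_take // (leq_trans _ le_im) // le_nth // lt_i_t -ltnS lt_ji.
  rewrite all_count size_takel // => /eqP <-.
  by rewrite -[in leqRHS](cat_take_drop i.+1 t) count_cat leq_addr.
apply: contraTT; rewrite -ltnNge -leqNgt => lt_mi.
rewrite -(cat_take_drop i t) count_cat.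
suff -> : count (leq^~ m) (drop i t) = 0.
  by rewrite addn0 (leq_trans (count_size _ _)) // size_takel // ltnW.
apply/eqP; rewrite -leqn0 leqNgt -has_count -all_predC.
apply/(all_nthP 0) => j; rewrite size_drop nth_drop /= => lt_j.
by rewrite -ltnNge (leq_trans lt_mi) // le_nth; lia.
Qed.

Section Bounds.
Variables (T : finType) (G : sgraph T).
Local Notation n := (gorder T).

Lemma deg_lt_order (v : T) : deg G v < n.
Proof.
rewrite -[n]cardsT proper_card // properT; apply/eqP => /setP/(_ v).
by rewrite !inE adj_irrefl.
Qed.

Lemma independent_adjF (S : {set T}) (x y : T) :
  independent G S -> x \in S -> y \in S -> G x y = false.
Proof.
by move=> /forall_inP indS Sx Sy; apply/negbTE/(forall_inP (indS x Sx)).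
Qed.

Lemma independent_nk_cond (S : {set T}) (v : T) :
  independent G S -> v \in S -> nk_cond G #|S| v.
Proof.
move=> indS Sv; have [S1|S_neq1] := eqVneq #|S| 1; first by rewrite /nk_cond S1.
have S_gt0 : 0 < #|S| by apply/card_gt0P; exists v.
rewrite /nk_cond (negPf S_neq1) /=; have S_gt1 : 1 < #|S| by lia.
have disj w : w \in S -> nbh G w \subset ~: S.
  move=> Sw; apply/subsetP => x; rewrite !inE; apply: contraL => Sx.
  by rewrite (independent_adjF indS).
have cardSC : #|~: S| = n - #|S| by rewrite cardsCs setCK.
have S_le : #|S| <= n by apply: max_card.
have deg_le : deg G v <= n - #|S| by rewrite -cardSC subset_leq_card ?disj.
rewrite S_gt1 /=; apply/andP; split; first lia.
(* With k = [#|S|], numbering from 2 makes [nk v k] the 0-based entry k - 2, so k - 1 small values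
   are needed; the vertices of [S :\ v] supply them. *)
have cnt : #|S| - 2 < count (leq^~ (n - #|S|))
  [seq #|nbh G v :|: nbh G w| | w <- enum T & (w != v) && ~~ G v w].
  rewrite count_map count_filter -size_filter.
  have -> : #|S| - 2 = #|S :\ v|.-1 by rewrite (cardsD1 v S) Sv; lia.
  rewrite prednK; last by rewrite (cardsD1 v S) Sv in S_gt1; lia.
  rewrite cardE uniq_leq_size ?enum_uniq // => w.
  rewrite mem_enum in_setD1 mem_filter mem_enum /= => /andP[w_neq Sw].
  rewrite w_neq (independent_adjF indS) // !andbT -cardSC.
  by rewrite subset_leq_card // subUset !disj.
(* The same count shows that entry k - 2 exists, so the default 0 of [nth] is not read. *)
by rewrite /nk nth_sort_leq //; apply: leq_trans cnt (count_size _ _).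
Qed.

Lemma alpha_le_p2 : alpha G <= p2 G.
Proof.
(* The range in [p2] starts at 1, so the empty set is treated apart. *)
apply/bigmax_leqP => S indS; have [->//|S_gt0] := posnP #|S|.
apply: (@leq_bigmax_seq _ _ _ id).
  by rewrite mem_index_iota S_gt0 ltnS max_card.
apply/subset_leq_card/subsetP => v Sv.
by rewrite inE independent_nk_cond.
Qed.

Lemma degseq_le (i m : nat) : 0 < i <= n ->
  (degseq G i <= m) = (i <= #|[set v | deg G v <= m]|).
Proof.
move=> /andP[i_gt0 le_in]; rewrite /degseq nth_sort_leq.
  rewrite prednK // count_map -size_filter cardE.
  by rewrite enumT; congr (_ <= size _); apply: eq_filter => v; rewrite /= inE.
by rewrite size_map -cardE prednK.
Qed.

(** For k >= 2 this rearranges the requirement that n_k(v) be defined; for k = 1 it is d(v) < n. *)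
Lemma nk_cond_deg (k : nat) (v : T) : nk_cond G k v -> deg G v <= n - k.
Proof. by have lt_n := deg_lt_order v; case/orP => [/eqP|/and3P[]]; lia. Qed.

Lemma p2_le_p1 : p2 G <= p1 G.
Proof.
apply/bigmax_leqP_seq => k; rewrite mem_index_iota => k_in le_k.
apply: (@leq_bigmax_seq _ _ _ id); rewrite ?mem_index_iota //.
rewrite degseq_le // (leq_trans le_k) // subset_leq_card //.
by apply/subsetP => v; rewrite !inE; apply: nk_cond_deg.
Qed.

(** Double counting of incident pairs (v, E): each edge has two distinct ends, and the edges at v
    lie in the image of N(v) under y -> {v, y}. This half of the handshake identity suffices for an
    upper bound on 2m. *)
Lemma double_edges_le : 2 * #|edges G| <= \sum_v deg G v.
Proof.
have edgeP E : E \in edges G -> exists x y, G x y /\ E = [set x; y].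
  by rewrite inE => /existsP[x /existsP[y /andP[Gxy /eqP->]]]; exists x, y.
have -> : 2 * #|edges G| = \sum_(E in edges G) \sum_(v in E) 1.
  rewrite mulnC -sum_nat_const; apply: eq_bigr => E /edgeP[x [y [Gxy ->]]].
  by rewrite sum1_card cards2; case: eqP Gxy => // ->; rewrite adj_irrefl.
rewrite (exchange_big_dep predT) //=; apply: leq_sum => v _.
rewrite sum1_card /deg.
apply: leq_trans (leq_imset_card (fun y => [set v; y]) (nbh G v)).
apply/subset_leq_card/subsetP => E /andP[/edgeP[x [y [Gxy ->]]]].
rewrite !inE => /orP[]/eqP->; apply/imsetP; first by exists y; rewrite ?inE.
by exists x; rewrite ?inE 1?adj_sym // setUC.
Qed.

Lemma sum_deg_le (i : nat) : 0 < i <= n -> degseq G i <= n - i ->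
  \sum_v deg G v <= i * (n - i) + (n - i) * (n - 1).
Proof.
move=> i_in; rewrite degseq_le //; set A := [set v | _] => le_iA.
rewrite (bigID (mem A)) /=.
have le1 : \sum_(v in A) deg G v <= #|A| * (n - i).
  by rewrite -sum_nat_const; apply: leq_sum => v; rewrite inE.
have le2 : \sum_(v | v \notin A) deg G v <= (n - #|A|) * (n - 1).
  have -> : n - #|A| = #|[predC A]| by rewrite /gorder -(cardC A) addKn.
  by rewrite -sum_nat_const; apply: leq_sum => v _; have := deg_lt_order v; lia.
have le_An : #|A| <= n by apply: max_card.
(* [A] may have more than i vertices, but a|n - i| + (n - a)(n - 1) does not increase with a, since
   n - i <= n - 1. *)
nia.
Qed.

Import Order.TTheory GRing.Theory Num.Theory.
Local Open Scope ring_scope.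

Lemma p1_le_p (R : realType) : (p1 G)%:Z <= p G R.
Proof.
(* An integer is below the floor iff it is below the real number, and that bound passes to maxima;
   it remains to check 0 and each admissible i. *)
rewrite /p floor_ge_int -pmulrn /p1 big_seq_cond.
elim/big_ind: _ => [|j k le_j le_k|i].
- by rewrite addr_ge0 ?sqrtr_ge0 // invr_ge0.
- by rewrite /maxn; case: ifP.
rewrite mem_index_iota ltnS => /andP[i_in /(sum_deg_le i_in) sum_le].
have le_m : (2 * #|edges G| <= i * (n - i) + (n - i) * (n - 1))%N.
  exact: leq_trans double_edges_le sum_le.
rewrite -lerBlDl; case/andP: i_in => i_gt0 le_in.
(* Writing |i - 1/2| as the root of its square reduces the claim to comparing radicands. There the
   mixed terms in n and i cancel. *)
apply: (le_trans (ler_norm _)); rewrite -sqrtr_sqr ler_wsqrtr //.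
move: le_m; rewrite -(ler_nat R) natrD !natrM !natrB //; last lia.
set N := n%:R : R; set I := i%:R : R; set m := _%:R : R => le_m.
nra.
Qed.

End Bounds.

Theorem theorem7 (R : realType) (T : finType) (G : sgraph T) :
  [/\ (alpha G <= p2 G)%N,
      (p2 G <= p1 G)%N
    & ((p1 G)%:Z <= p G R)%R].
Proof. by split; [apply: alpha_le_p2 | apply: p2_le_p1 | apply: p1_le_p]. Qed.
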